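(* Let $\Pi\colon D\to Z$ be a like-Hermitian vector bundle, let $p_1,p_2\colon Z\times Z\to Z$ be the natural projections, and let $K\colon Z\times Z\to\mathrm{Hom}(p_2^*\Pi,p_1^*\Pi)$ be a reproducing $(-* )$-kernel on $\Pi$, with associated reproducing kernel Hilbert space $\mathcal H^K$. Define $$\widehat K\colon D\to\mathcal H^K,\quad \widehat K(\xi)=K_\xi=K(\cdot,\Pi(\xi))\xi,\qquad\text{and}\qquad \zeta_K\colon Z\to\mathrm{Gr}(\mathcal H^K),\quad \zeta_K(s):=\overline{\widehat K(D_s)}.$$ Assume that $\Omega=(\gamma,\omega)$ is an involutive morphism on the tautological vector bundle $\Pi_{\mathcal H^K}$ such that the involutive diffeomorphism $\mathcal S\mapsto\mathcal S^{-*}:=\omega(\mathcal S)$ of $\mathrm{Gr}(\mathcal H^K)$ satisfies $$\zeta_K(s^{-*})=\zeta_K(s)^{-*}\qquad\text{for all } s\in Z.$$ Then there exists a vector bundle morphism (in the algebraic sense) $\Delta_K=(\delta_K,\zeta_K)$ from $\Pi$ into the like-Hermitian vector bundle $\Pi_{\mathcal H^K,\Omega}$ such that $K$ is equal to the pull-back of the reproducing $(-* )$-kernel $Q_{\mathcal H^K,\Omega}$ by $\Delta_K$, that is, $K=(\Delta_K)^*Q_{\mathcal H^K,\Omega}$.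
   Context: **Like-Hermitian bundles.** Let $Z$ be a real Banach manifold with an involutive diffeomorphism $z\mapsto z^{-*}$. A like-Hermitian structure on a smooth vector bundle $\Pi\colon D\to Z$ (typical fiber a complex Banach space $\mathcal E$, fibers $D_z=\Pi^{-1}(z)$) is a family $\{(\cdot\mid\cdot)_{z,z^{-*}}\}_{z\in Z}$ such that: (a) each $(\cdot\mid\cdot)_{z,z^{-*}}\colon D_z\times D_{z^{-*}}\to\mathbb C$ is a sesquilinear strong duality pairing, i.e. it is continuous, linear in the first and antilinear in the second variable, and $\xi\mapsto(\xi\mid\cdot)_{z,z^{-*}}$, $D_z\to(\overline{D_{z^{-*}}})^*$, and $\eta\mapsto(\cdot\mid\eta)_{z,z^{-*}}$, $\overline{D_{z^{-*}}}\to D_z^*$, are (not necessarily isometric) isomorphisms of complex Banach spaces (bar denotes the complex-conjugate space); (b) $\overline{(\xi\mid\eta)}_{z,z^{-*}}=(\eta\mid\xi)_{z^{-*},z}$; (c) for trivializations $\Psi_V,\Psi_{V^{-*}}$ of $\Pi$ over open $V$ and $V^{-*}=\{z^{-*}\mid z\in V\}$, the function $(z,x,y)\mapsto(\Psi_V(z,x)\mid\Psi_{V^{-*}}(z^{-*},y))_{z,z^{-*}}$ is smooth on $V\times\mathcal E\times\mathcal E$. **Reproducing $(-* )$-kernels.** A reproducing $(-* )$-kernel on $\Pi$ is a section $K$ of $\mathrm{Hom}(p_2^*\Pi,p_1^*\Pi)$ over $Z\times Z$, i.e. bounded linear operators $K(s,t)\colon D_t\to D_s$ for all $s,t\in Z$,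 such that $\sum_{j,l=1}^n(K(t_l,t_j^{-*})\eta_j\mid\eta_l)_{t_l,t_l^{-*}}\ge0$ for all $n\ge1$, $t_j\in Z$, $\eta_j\in D_{t_j^{-*}}$. For $\xi\in D_s$ put $K_\xi=K(\cdot,s)\xi$, a section of $\Pi$. $\mathcal H^K$ is the Hilbert space completion of $\mathrm{span}\{K_\xi\mid\xi\in D\}$ for the scalar product $(K_\eta\mid K_\xi)_{\mathcal H^K}=(K(s^{-*},t)\eta\mid\xi)_{s^{-*},s}$, $\xi\in D_s$, $\eta\in D_t$. **Morphisms and pull-backs.** An (algebraic) morphism from a like-Hermitian bundle $\widetilde\Pi\colon\widetilde D\to\widetilde Z$ into $\Pi\colon D\to Z$ is a pair $\Theta=(\delta,\zeta)$ of maps $\delta\colon\widetilde D\to D$, $\zeta\colon\widetilde Z\to Z$ with $\Pi\circ\delta=\zeta\circ\widetilde\Pi$, with $\delta_z:=\delta|_{\widetilde D_z}\colon\widetilde D_z\to D_{\zeta(z)}$ bounded linear, and $\zeta(z^{-*})=\zeta(z)^{-*}$ (no continuity or smoothness of $\delta,\zeta$ is required here). For each $z$ there is a unique bounded linear $(\delta_z)^{-*}\colon D_{\zeta(z)^{-*}}\to\widetilde D_{z^{-*}}$ with $(\delta_z\xi\mid\eta)_{\zeta(z),\zeta(z)^{-*}}=(\xi\mid(\delta_z)^{-*}\eta)_{z,z^{-*}}$. The pull-back of a reproducing $(-* )$-kernel $K$ on $\Pi$ is $\Theta^*K(s,t)=(\delta_{s^{-*}})^{-*}\circ K(\zeta(s),\zeta(t))\circ\delta_t$,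 $s,t\in\widetilde Z$. **Tautological bundle.** For a complex Hilbert space $\mathcal H$, $\mathrm{Gr}(\mathcal H)$ is the Grassmann manifold of all closed linear subspaces of $\mathcal H$, $\mathcal T(\mathcal H)=\{(\mathcal S,x)\in\mathrm{Gr}(\mathcal H)\times\mathcal H\mid x\in\mathcal S\}$, $\Pi_{\mathcal H}\colon\mathcal T(\mathcal H)\to\mathrm{Gr}(\mathcal H)$, $(\mathcal S,x)\mapsto\mathcal S$ (a holomorphic Hermitian vector bundle), and $p_{\mathcal S}\colon\mathcal H\to\mathcal S$ is the orthogonal projection. An involutive morphism on $\Pi_{\mathcal H}$ is a pair $\Omega=(\gamma,\omega)$ of smooth maps $\gamma\colon\mathcal T(\mathcal H)\to\mathcal T(\mathcal H)$, $\omega\colon\mathrm{Gr}(\mathcal H)\to\mathrm{Gr}(\mathcal H)$ with $\Pi_{\mathcal H}\circ\gamma=\omega\circ\Pi_{\mathcal H}$ such that: (a) $\omega$ is an involutive diffeomorphism, written $\mathcal S\mapsto\mathcal S^{-*}$; (b) for every $\mathcal S$, $\gamma_{\mathcal S}\colon\mathcal S\to\mathcal S^{-*}$ is an isometric linear bijection and $\gamma_{\mathcal S^{-*}}=(\gamma_{\mathcal S})^{-1}$; (c) $(x_1\mid x_2)_{\mathcal H}=(\gamma_{\mathcal S_1}(x_1)\mid\gamma_{\mathcal S_2}(x_2))_{\mathcal H}$ for all $\mathcal S_1,\mathcal S_2\in\mathrm{Gr}(\mathcal H)$, $x_j\in\mathcal S_j$. $\Pi_{\mathcal H,\Omega}$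 denotes $\Pi_{\mathcal H}$ with the involution $\omega$ on the base and the like-Hermitian structure $(x\mid y)_{\mathcal S,\mathcal S^{-*}}=(x\mid\gamma_{\mathcal S^{-*}}(y))_{\mathcal H}$, $x\in\mathcal S$, $y\in\mathcal S^{-*}$. Its reproducing $(-* )$-kernel is $Q_{\mathcal H,\Omega}(\mathcal S_1,\mathcal S_2)=p_{\mathcal S_1}\circ\gamma_{\mathcal S_2}\colon\mathcal S_2\to\mathcal S_1$. *)

(* Defs.v *)
From Stdlib Require Import Reals Lra.
From Stdlib Require Import FunctionalExtensionality PropExtensionality.
From Stdlib Require Import ProofIrrelevance ClassicalEpsilon.
From Coquelicot Require Import Coquelicot.

Set Implicit Arguments.
Unset Strict Implicit.
Unset Printing Implicit Defensive.

Open Scope R_scope.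

Record blin (K : AbsRing) (E F : NormedModule K) := Blin
  { blin_fun :> E -> F; blin_is_linear : is_linear blin_fun }.
Arguments Blin {K E F} _ _.
Arguments blin_is_linear {K E F} _.

Lemma blin_ext (K : AbsRing) (E F : NormedModule K) (f g : blin E F) :
  (forall x, f x = g x) -> f = g.
Proof.
  destruct f as [f hf], g as [g hg]; simpl; intros h.
  assert (e : f = g) by (apply functional_extensionality; exact h).
  subst g; f_equal; apply proof_irrelevance.
Qed.

Definition blin_zero (K : AbsRing) (E F : NormedModule K) : blin E F :=
  Blin (fun _ => zero) is_linear_zero.

Definition blin_comp (K : AbsRing) (E F G : NormedModule K)
    (g : blin F G) (f : blin E F) : blin E G :=
  Blin (fun x => g (f x))
    (is_linear_comp f g (blin_is_linear f) (blin_is_linear g)).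

(** Topological linear isomorphisms, not necessarily isometric. *)
Definition linear_iso (K : AbsRing) (E F : NormedModule K) (f : E -> F) : Prop :=
  is_linear f /\
  exists g : F -> E,
    is_linear g /\ (forall x, g (f x) = x) /\ (forall y, f (g y) = y).

Section OperatorSpace.

Variables (K : AbsRing) (Kcomm : forall a b : K, mult a b = mult b a).
Variables E F : NormedModule K.

Let is_bound (f : E -> F) (M : R) : Prop :=
  0 <= M /\ forall x, norm (f x) <= M * norm x.

Definition op_norm (f : E -> F) : R := real (Glb_Rbar (is_bound f)).

Lemma op_norm_spec (f : E -> F) (M0 : R) : is_bound f M0 ->
  is_bound f (op_norm f) /\ forall M, is_bound f M -> op_norm f <= M.
Proof.
  intros h0. unfold op_norm.
  destruct (Glb_Rbar_correct (is_bound f)) as [lb glb].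
  destruct (Glb_Rbar (is_bound f)) as [m | |]; simpl.
  - assert (hm : 0 <= m).
    { apply (glb (Finite 0)). intros M [hM _]. exact hM. }
    split; [split; [exact hm|] | intros M hM; exact (lb M hM)].
    intros x. destruct (Rle_lt_or_eq_dec 0 (norm x) (norm_ge_0 x)) as [hx|hx].
    + assert (hd : norm (f x) / norm x <= m).
      { apply (glb (Finite (norm (f x) / norm x))). intros M [_ hM]. simpl.
        apply Rmult_le_reg_r with (norm x); [exact hx|].
        unfold Rdiv; rewrite Rmult_assoc, Rinv_l, Rmult_1_r; [apply hM | lra]. }
      apply Rmult_le_compat_r with (r := norm x) in hd; [|lra].
      unfold Rdiv in hd; rewrite Rmult_assoc, Rinv_l, Rmult_1_r in hd; lra.
    + destruct h0 as [_ h0]. specialize (h0 x). rewrite <- hx in h0 |- *. lra.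
  - destruct (lb M0 h0).
  - exfalso. exact (glb (Finite 0) (fun M hM => proj1 hM)).
Qed.

Lemma blin_bound (f : blin E F) : exists M, is_bound f M.
Proof.
  destruct (linear_norm _ (blin_is_linear f)) as [M [hM h]].
  exists M. split; [lra | exact h].
Qed.

Lemma op_norm_ge_0 (f : blin E F) : 0 <= op_norm f.
Proof. destruct (blin_bound f) as [M hM]. apply (op_norm_spec hM). Qed.

Lemma op_norm_le (f : blin E F) (x : E) : norm (f x) <= op_norm f * norm x.
Proof. destruct (blin_bound f) as [M hM]. apply (op_norm_spec hM). Qed.

Lemma op_norm_min (f : E -> F) (M : R) :
  0 <= M -> (forall x, norm (f x) <= M * norm x) -> op_norm f <= M.
Proof.
  intros h1 h2. assert (h : is_bound f M) by (split; assumption).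
  apply (op_norm_spec h); exact h.
Qed.

Definition blin_plus (f g : blin E F) : blin E F.
Proof.
  refine (Blin (fun x => plus (f x) (g x)) _).
  exact (is_linear_comp (fun x => (f x, g x)) (fun p => plus (fst p) (snd p))
    (is_linear_prod _ _ (blin_is_linear f) (blin_is_linear g)) is_linear_plus).
Defined.

Definition blin_opp (f : blin E F) : blin E F :=
  Blin (fun x => opp (f x))
    (is_linear_comp f _ (blin_is_linear f) is_linear_opp).

Definition blin_scal (k : K) (f : blin E F) : blin E F :=
  Blin (fun x => scal k (f x))
    (is_linear_comp f _ (blin_is_linear f) (is_linear_scal_r k Kcomm)).

Definition blin_AbelianMonoid_mixin : AbelianMonoid.mixin_of (blin E F).
Proof.
  apply (AbelianMonoid.Mixin (blin E F) blin_plus (blin_zero E F));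
    intros; apply blin_ext; intros; simpl.
  - apply plus_comm.
  - apply plus_assoc.
  - apply plus_zero_r.
Defined.

Definition blin_AbelianMonoid :=
  AbelianMonoid.Pack (blin E F) blin_AbelianMonoid_mixin (blin E F).

Definition blin_AbelianGroup_mixin : AbelianGroup.mixin_of blin_AbelianMonoid.
Proof.
  apply (AbelianGroup.Mixin blin_AbelianMonoid blin_opp).
  intros f; apply blin_ext; intros x; exact (plus_opp_r (f x)).
Defined.

Definition blin_AbelianGroup :=
  AbelianGroup.Pack (blin E F)
    (AbelianGroup.Class _ blin_AbelianMonoid_mixin blin_AbelianGroup_mixin)
    (blin E F).

Definition blin_ModuleSpace_mixin : ModuleSpace.mixin_of K blin_AbelianGroup.
Proof.
  apply (ModuleSpace.Mixin K blin_AbelianGroup blin_scal);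
    intros; apply blin_ext; intros; simpl.
  - apply scal_assoc.
  - apply (@scal_one K F).
  - apply (@scal_distr_l K F).
  - apply (@scal_distr_r K F).
Defined.

Definition blin_ModuleSpace_class :=
  ModuleSpace.Class K (blin E F) _ blin_ModuleSpace_mixin.

Lemma op_norm_plus (f g : blin E F) :
  op_norm (blin_plus f g) <= op_norm f + op_norm g.
Proof.
  pose proof (op_norm_ge_0 f); pose proof (op_norm_ge_0 g).
  apply op_norm_min; [lra|]. intros x; simpl.
  eapply Rle_trans; [apply norm_triangle|].
  pose proof (op_norm_le f x); pose proof (op_norm_le g x). lra.
Qed.

Lemma op_norm_scal (k : K) (f : blin E F) :
  op_norm (blin_scal k f) <= abs k * op_norm f.
Proof.
  pose proof (op_norm_ge_0 f); pose proof (abs_ge_0 k).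
  apply op_norm_min; [apply Rmult_le_pos; lra|]. intros x; simpl.
  eapply Rle_trans; [apply norm_scal|]. rewrite Rmult_assoc.
  apply Rmult_le_compat_l; [lra | apply op_norm_le].
Qed.

Lemma op_norm_zero : op_norm (blin_zero E F) = 0.
Proof.
  apply Rle_antisym; [|apply op_norm_ge_0].
  apply op_norm_min; [lra|]. intros x; simpl. rewrite norm_zero; lra.
Qed.

Lemma op_norm_opp (f : blin E F) : op_norm (blin_opp f) <= op_norm f.
Proof.
  apply op_norm_min; [apply op_norm_ge_0|]. intros x; simpl.
  rewrite norm_opp; apply op_norm_le.
Qed.

Definition blin_ball (f : blin E F) (eps : R) (g : blin E F) : Prop :=
  op_norm (minus (g : blin_AbelianGroup) f : blin E F) < eps.

Definition blin_UniformSpace_mixin : UniformSpace.mixin_of (blin E F).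
Proof.
  apply (UniformSpace.Mixin (blin E F) (blin_zero E F) blin_ball);
    unfold blin_ball.
  - intros f eps. rewrite (minus_eq_zero (f : blin_AbelianGroup)).
    change (op_norm (blin_zero E F) < eps). rewrite op_norm_zero. apply eps.
  - intros f g eps h. rewrite <- (opp_minus (g : blin_AbelianGroup) f).
    eapply Rle_lt_trans; [apply op_norm_opp | exact h].
  - intros f g h e1 e2 h1 h2.
    rewrite (minus_trans (g : blin_AbelianGroup) h f).
    eapply Rle_lt_trans; [apply op_norm_plus | lra].
Defined.

Definition blin_NormedModuleAux :=
  NormedModuleAux.Pack K (blin E F)
    (NormedModuleAux.Class K (blin E F)
      blin_ModuleSpace_class blin_UniformSpace_mixin) (blin E F).

Definition blin_NormedModule_mixin : NormedModule.mixin_of K blin_NormedModuleAux.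
Proof.
  apply (NormedModule.Mixin K blin_NormedModuleAux
           (op_norm : blin E F -> R) 1).
  - exact op_norm_plus.
  - exact op_norm_scal.
  - intros f g eps h; exact h.
  - intros f g eps h; rewrite Rmult_1_l; exact h.
  - intros f h. apply blin_ext; intros x; simpl. apply norm_eq_zero.
    apply Rle_antisym; [|apply norm_ge_0].
    pose proof (op_norm_le f x) as hx. rewrite h in hx. lra.
Defined.

Definition blin_NormedModule : NormedModule K :=
  NormedModule.Pack K (blin E F)
    (NormedModule.Class K (blin E F) _ blin_NormedModule_mixin) (blin E F).

End OperatorSpace.

Definition LR (E F : NormedModule R_AbsRing) : NormedModule R_AbsRing :=
  blin_NormedModule Rmult_comm E F.

Definition LC (E F : NormedModule C_AbsRing) : NormedModule C_AbsRing :=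
  blin_NormedModule Cmult_comm E F.

Section ChangeOfScalars.

Variable V : NormedModule C_AbsRing.

Definition real_ModuleSpace_mixin : ModuleSpace.mixin_of R_AbsRing V.
Proof.
  apply (ModuleSpace.Mixin R_AbsRing V
           (fun (r : R) (x : V) => scal (RtoC r : C_AbsRing) x)).
  - intros x y u. rewrite scal_assoc. f_equal. symmetry; apply RtoC_mult.
  - intros u. apply (@scal_one C_AbsRing V).
  - intros x u v. apply (@scal_distr_l C_AbsRing V).
  - intros x y u. rewrite <- (@scal_distr_r C_AbsRing V). f_equal.
    apply RtoC_plus.
Defined.

Definition real_NormedModuleAux :=
  NormedModuleAux.Pack R_AbsRing V
    (NormedModuleAux.Class R_AbsRing V
      (ModuleSpace.Class R_AbsRing V _ real_ModuleSpace_mixin)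
      (UniformSpace.class V)) V.

Definition real_NormedModule_mixin :
  NormedModule.mixin_of R_AbsRing real_NormedModuleAux.
Proof.
  apply (NormedModule.Mixin R_AbsRing real_NormedModuleAux
           (fun x : V => norm x) (@norm_factor C_AbsRing V)).
  - apply (@norm_triangle C_AbsRing V).
  - intros l x. rewrite <- Cmod_R. apply (@norm_scal C_AbsRing V).
  - apply (@norm_compat1 C_AbsRing V).
  - apply (@norm_compat2 C_AbsRing V).
  - apply (@norm_eq_zero C_AbsRing V).
Defined.

Definition realify : NormedModule R_AbsRing :=
  NormedModule.Pack R_AbsRing V
    (NormedModule.Class R_AbsRing V _ real_NormedModule_mixin) V.

Definition conj_ModuleSpace_mixin : ModuleSpace.mixin_of C_AbsRing V.
Proof.
  apply (ModuleSpace.Mixin C_AbsRing V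
           (fun (a : C) (x : V) => scal (Cconj a : C_AbsRing) x)).
  - intros x y u. rewrite scal_assoc. f_equal. symmetry; apply Cmult_conj.
  - intros u. rewrite <- (@scal_one C_AbsRing V u) at 2. f_equal.
    apply injective_projections; simpl; lra.
  - intros x u v. apply (@scal_distr_l C_AbsRing V).
  - intros x y u. rewrite <- (@scal_distr_r C_AbsRing V). f_equal.
    apply Cplus_conj.
Defined.

Definition conj_NormedModuleAux :=
  NormedModuleAux.Pack C_AbsRing V
    (NormedModuleAux.Class C_AbsRing V
      (ModuleSpace.Class C_AbsRing V _ conj_ModuleSpace_mixin)
      (UniformSpace.class V)) V.

Definition conj_NormedModule_mixin :
  NormedModule.mixin_of C_AbsRing conj_NormedModuleAux.
Proof.
  apply (NormedModule.Mixin C_AbsRing conj_NormedModuleAux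
           (fun x : V => norm x) (@norm_factor C_AbsRing V)).
  - apply (@norm_triangle C_AbsRing V).
  - intros l x. change (abs l) with (Cmod l). rewrite <- Cmod_conj.
    apply (@norm_scal C_AbsRing V).
  - apply (@norm_compat1 C_AbsRing V).
  - apply (@norm_compat2 C_AbsRing V).
  - apply (@norm_eq_zero C_AbsRing V).
Defined.

Definition conj_space : NormedModule C_AbsRing :=
  NormedModule.Pack C_AbsRing V
    (NormedModule.Class C_AbsRing V _ conj_NormedModule_mixin) V.

End ChangeOfScalars.

Notation CBanach := (CompleteNormedModule C_AbsRing).

Record linear_subspace (V : NormedModule C_AbsRing) (P : V -> Prop) : Prop :=
  { subspace_zero : P zero;
    subspace_plus : forall x y, P x -> P y -> P (plus x y);
    subspace_scal : forall (a : C_AbsRing) x, P x -> P (scal a x) }.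

Record closed_subspace (V : CBanach) := ClosedSubspace
  { mem : V -> Prop;
    mem_linear : linear_subspace mem;
    mem_closed : closed mem }.

Lemma closed_subspace_ext (V : CBanach) (S T : closed_subspace V) :
  (forall x, mem S x <-> mem T x) -> S = T.
Proof.
  destruct S as [S hS cS], T as [T hT cT]; simpl; intros h.
  assert (e : S = T).
  { apply functional_extensionality; intros x.
    apply propositional_extensionality; apply h. }
  subst T; f_equal; apply proof_irrelevance.
Qed.

Section Subspace.

Variables (V : CBanach) (S : closed_subspace V).

Definition sub_carrier : Type := { x : V | mem S x }.

Definition sub_val (x : sub_carrier) : V := proj1_sig x.

Lemma sub_val_inj (x y : sub_carrier) : sub_val x = sub_val y -> x = y.
Proof.
  destruct x as [x hx], y as [y hy]; simpl; intros e; subst y.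
  f_equal; apply proof_irrelevance.
Qed.

Definition sub_zero : sub_carrier := exist _ zero (subspace_zero (mem_linear S)).

Definition sub_plus (x y : sub_carrier) : sub_carrier :=
  exist _ (plus (sub_val x) (sub_val y))
    (subspace_plus (mem_linear S) (proj2_sig x) (proj2_sig y)).

Definition sub_scal (a : C_AbsRing) (x : sub_carrier) : sub_carrier :=
  exist _ (scal a (sub_val x)) (subspace_scal (mem_linear S) a (proj2_sig x)).

Lemma mem_opp (x : V) : mem S x -> mem S (opp x).
Proof.
  intros h.
  replace (opp x) with (scal (opp one : C_AbsRing) x)
    by exact (@scal_opp_one C_AbsRing V x).
  apply (subspace_scal (mem_linear S)); exact h.
Qed.

Definition sub_opp (x : sub_carrier) : sub_carrier :=
  exist _ (opp (sub_val x)) (mem_opp (proj2_sig x)).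

Definition sub_AbelianMonoid_mixin : AbelianMonoid.mixin_of sub_carrier.
Proof.
  apply (AbelianMonoid.Mixin sub_carrier sub_plus sub_zero);
    intros; apply sub_val_inj; simpl.
  - apply plus_comm.
  - apply plus_assoc.
  - apply plus_zero_r.
Defined.

Definition sub_AbelianMonoid :=
  AbelianMonoid.Pack sub_carrier sub_AbelianMonoid_mixin sub_carrier.

Definition sub_AbelianGroup_mixin : AbelianGroup.mixin_of sub_AbelianMonoid.
Proof.
  apply (AbelianGroup.Mixin sub_AbelianMonoid sub_opp).
  intros x; apply sub_val_inj; exact (plus_opp_r (sub_val x)).
Defined.

Definition sub_AbelianGroup :=
  AbelianGroup.Pack sub_carrier
    (AbelianGroup.Class _ sub_AbelianMonoid_mixin sub_AbelianGroup_mixin)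
    sub_carrier.

Definition sub_ModuleSpace_mixin :
  ModuleSpace.mixin_of C_AbsRing sub_AbelianGroup.
Proof.
  apply (ModuleSpace.Mixin C_AbsRing sub_AbelianGroup sub_scal);
    intros; apply sub_val_inj; simpl.
  - apply scal_assoc.
  - apply (@scal_one C_AbsRing V).
  - apply (@scal_distr_l C_AbsRing V).
  - apply (@scal_distr_r C_AbsRing V).
Defined.

Definition sub_UniformSpace_mixin : UniformSpace.mixin_of sub_carrier.
Proof.
  apply (UniformSpace.Mixin sub_carrier sub_zero
           (fun x eps y => ball (sub_val x) eps (sub_val y))).
  - intros; apply ball_center.
  - intros; apply ball_sym; assumption.
  - intros; eapply ball_triangle; eassumption.
Defined.

Definition sub_UniformSpace :=
  UniformSpace.Pack sub_carrier sub_UniformSpace_mixin sub_carrier.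

Definition sub_NormedModuleAux :=
  NormedModuleAux.Pack C_AbsRing sub_carrier
    (NormedModuleAux.Class C_AbsRing sub_carrier
      (ModuleSpace.Class C_AbsRing sub_carrier _ sub_ModuleSpace_mixin)
      sub_UniformSpace_mixin) sub_carrier.

Definition sub_NormedModule_mixin :
  NormedModule.mixin_of C_AbsRing sub_NormedModuleAux.
Proof.
  apply (NormedModule.Mixin C_AbsRing sub_NormedModuleAux
           (fun x : sub_carrier => norm (sub_val x)) (@norm_factor C_AbsRing V)).
  - intros x y; apply (@norm_triangle C_AbsRing V).
  - intros l x; apply (@norm_scal C_AbsRing V).
  - intros x y; apply (@norm_compat1 C_AbsRing V).
  - intros x y; apply (@norm_compat2 C_AbsRing V).
  - intros x h; apply sub_val_inj. exact (@norm_eq_zero C_AbsRing V (sub_val x) h).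
Defined.

Definition sub_NormedModule_class :=
  NormedModule.Class C_AbsRing sub_carrier _ sub_NormedModule_mixin.

Definition push_sub (F : (sub_carrier -> Prop) -> Prop) : (V -> Prop) -> Prop :=
  fun P => F (fun x => P (sub_val x)).

Definition sub_lim (F : (sub_carrier -> Prop) -> Prop) : sub_carrier :=
  match excluded_middle_informative (mem S (lim (push_sub F))) with
  | left h => exist _ (lim (push_sub F)) h
  | right _ => sub_zero
  end.

Definition sub_CompleteSpace_mixin : CompleteSpace.mixin_of sub_UniformSpace.
Proof.
  apply (CompleteSpace.Mixin sub_UniformSpace sub_lim).
  - intros F PF CF eps.
    assert (PG : ProperFilter (push_sub F)).
    { split.
      - intros P HP. destruct (filter_ex (F := F) _ HP) as [x hx].
        exists (sub_val x); exact hx.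
      - split; unfold push_sub.
        + apply filter_true.
        + intros P Q; apply filter_and.
        + intros P Q h; apply filter_imp; intros x; apply h. }
    assert (CG : cauchy (push_sub F)).
    { intros e. destruct (CF e) as [x hx]. exists (sub_val x). exact hx. }
    pose proof (complete_cauchy (push_sub F) PG CG) as hl.
    unfold sub_lim. destruct (excluded_middle_informative _) as [h | h].
    + exact (hl eps).
    + exfalso; apply h. apply (@mem_closed V S). intros [e he].
      destruct (filter_ex (F := F) _ (hl e)) as [x hx]. exact (he _ hx (proj2_sig x)).
  - intros F1 F2 h12 h21 eps.
    assert (e : lim (push_sub F1) = lim (push_sub F2)).
    { apply (@eq_close C_AbsRing V).
      apply (@close_lim V); intros P HP; [apply h12 | apply h21]; exact HP. }
    unfold sub_lim. rewrite e. apply (@ball_center sub_UniformSpace).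
Defined.

Definition sub_space : CBanach :=
  CompleteNormedModule.Pack C_AbsRing sub_carrier
    (CompleteNormedModule.Class C_AbsRing sub_carrier
      sub_NormedModule_class sub_CompleteSpace_mixin) sub_carrier.

Definition sub_incl : blin sub_space V.
Proof.
  apply (Blin (sub_val : sub_space -> V)). split; try reflexivity.
  exists 1; split; [lra|]. intros x. rewrite Rmult_1_l. apply Rle_refl.
Defined.

End Subspace.

Coercion sub_space : closed_subspace >-> CompleteNormedModule.
Arguments sub_incl {V} S.

Lemma minus_plus_plus (G : AbelianGroup) (x y x' y' : G) :
  minus (plus x y) (plus x' y') = plus (minus x x') (minus y y').
Proof.
  unfold minus. rewrite opp_plus, <- !plus_assoc. f_equal.
  rewrite !plus_assoc. f_equal. apply plus_comm.
Qed.

Lemma closed_norm_approx (V : NormedModule C_AbsRing) (P : V -> Prop) :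
  (forall x, (forall eps, 0 < eps -> exists z, P z /\ norm (minus z x) < eps) -> P x) ->
  closed P.
Proof.
  intros h x hx. apply h. intros eps he. apply NNPP; intros hn. apply hx.
  apply (@locally_le_locally_norm C_AbsRing V).
  exists (mkposreal eps he). intros z hz hPz. apply hn. exists z; split; assumption.
Qed.

Definition closure (V : NormedModule C_AbsRing) (P : V -> Prop) : V -> Prop :=
  fun x => forall eps, 0 < eps -> exists y, P y /\ norm (minus x y) < eps.

Lemma closure_linear (V : NormedModule C_AbsRing) (P : V -> Prop) :
  linear_subspace P -> linear_subspace (closure P).
Proof.
  intros [h0 hp hs]. split.
  - intros eps he. exists zero; split; [exact h0|].
    rewrite minus_eq_zero.
    eapply Rle_lt_trans; [apply Req_le; exact (@norm_zero C_AbsRing V) | exact he].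
  - intros x y hx hy eps he.
    destruct (hx (eps / 2)) as [x' [px nx]]; [lra|].
    destruct (hy (eps / 2)) as [y' [py ny]]; [lra|].
    exists (plus x' y'); split; [apply hp; assumption|].
    replace (minus (plus x y) (plus x' y')) with (plus (minus x x') (minus y y')).
    + eapply Rle_lt_trans; [apply (@norm_triangle C_AbsRing V)|]. lra.
    + symmetry; exact (minus_plus_plus x y x' y').
  - intros a x hx eps he.
    pose proof (@abs_ge_0 C_AbsRing a) as ha.
    destruct (hx (eps / (abs a + 1))) as [x' [px nx]].
    { apply Rdiv_lt_0_compat; lra. }
    exists (scal a x'); split; [apply hs; exact px|].
    rewrite <- (@scal_minus_distr_l C_AbsRing V).
    eapply Rle_lt_trans; [apply (@norm_scal C_AbsRing V)|].
    apply Rle_lt_trans with ((abs a + 1) * norm (minus x x')).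
    { apply Rmult_le_compat_r; [apply (@norm_ge_0 C_AbsRing V)|].
      apply Rlt_le, Rlt_plus_1. }
    apply Rmult_lt_compat_l with (r := abs a + 1) in nx; [|lra].
    replace ((abs a + 1) * (eps / (abs a + 1))) with eps in nx by (field; lra).
    exact nx.
Qed.

Lemma closure_closed (V : NormedModule C_AbsRing) (P : V -> Prop) : closed (closure P).
Proof.
  apply closed_norm_approx. intros x hx eps he.
  destruct (hx (eps / 2)) as [z [hz nz]]; [lra|].
  destruct (hz (eps / 2)) as [y [hy ny]]; [lra|].
  exists y; split; [exact hy|].
  rewrite (minus_trans z x y).
  eapply Rle_lt_trans; [apply (@norm_triangle C_AbsRing V)|].
  rewrite <- (@norm_opp C_AbsRing V (minus x z)), (opp_minus x z). lra.
Qed.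

Definition closed_span (V : CBanach) (P : V -> Prop) (hP : linear_subspace P) :
    closed_subspace V :=
  ClosedSubspace (closure_linear hP) (@closure_closed V P).

Record hilbert := Hilbert
  { hilbert_space :> CBanach;
    inner : hilbert_space -> hilbert_space -> C;
    inner_plus_l : forall x y z, inner (plus x y) z = Cplus (inner x z) (inner y z);
    inner_scal_l : forall (a : C_AbsRing) x y, inner (scal a x) y = Cmult a (inner x y);
    inner_conj : forall x y, Cconj (inner x y) = inner y x;
    inner_norm : forall x, inner x x = RtoC (norm x * norm x) }.
Arguments inner {h} x y.

Section HilbertFacts.

Variable H : hilbert.
Implicit Types x y z : H.

Lemma inner_plus_r x y z : inner x (plus y z) = Cplus (inner x y) (inner x z).
Proof.
  rewrite <- inner_conj, inner_plus_l, Cplus_conj, !inner_conj. reflexivity.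
Qed.

Lemma inner_scal_r (a : C_AbsRing) x y :
  inner x (scal a y) = Cmult (Cconj a) (inner x y).
Proof.
  rewrite <- inner_conj, inner_scal_l, Cmult_conj, inner_conj. reflexivity.
Qed.

Lemma inner_zero_l y : inner (zero : H) y = RtoC 0.
Proof.
  replace (zero : H) with (scal (zero : C_AbsRing) (zero : H))
    by exact (@scal_zero_l C_AbsRing H zero).
  rewrite inner_scal_l. apply Cmult_0_l.
Qed.

Lemma cauchy_schwarz x y : Cmod (inner x y) <= norm x * norm y.
Proof.
  pose proof (@norm_ge_0 C_AbsRing H x) as hx.
  pose proof (@norm_ge_0 C_AbsRing H y) as hy.
  pose proof (Cmod_ge_0 (inner x y)) as ha.
  destruct (Req_dec (norm y) 0) as [e | ne].
  { apply (@norm_eq_zero C_AbsRing H) in e. subst y.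
    rewrite <- inner_conj, inner_zero_l.
    rewrite Cmod_conj, Cmod_0. apply Rmult_le_pos; assumption. }
  set (a := inner x y) in *.
  set (n := norm y * norm y).
  assert (hn : 0 < n) by (unfold n; nra).
  assert (key : RtoC (norm (plus (scal (RtoC n : C_AbsRing) x) (scal (Copp a : C_AbsRing) y))
                 * norm (plus (scal (RtoC n : C_AbsRing) x) (scal (Copp a : C_AbsRing) y)))
          = RtoC (n * (n * (norm x * norm x) - Cmod a * Cmod a))).
  { rewrite <- inner_norm.
    rewrite !inner_plus_l, !inner_plus_r, !inner_scal_l, !inner_scal_r.
    rewrite <- (inner_conj x y). rewrite !inner_norm.
    fold a n.
    replace (Cmod a * Cmod a) with (Cmod a ^ 2) by ring.
    rewrite (RtoC_mult n), RtoC_minus, (RtoC_mult n), Cmod2_conj.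
    replace (Cconj (RtoC n)) with (RtoC n)
      by (apply injective_projections; simpl; lra).
    rewrite Copp_conj. ring. }
  apply RtoC_inj in key.
  match type of key with ?u * ?u = _ => pose proof (Rle_0_sqr u) as hsq end.
  unfold Rsqr in hsq. rewrite key in hsq.
  assert (h2 : 0 <= n * (norm x * norm x) - Cmod a * Cmod a).
  { apply Rmult_le_reg_l with n; [exact hn|]. lra. }
  apply Rsqr_incr_0_var; [unfold Rsqr, n in *; lra | apply Rmult_le_pos; assumption].
Qed.

Lemma orth_linear (S : H -> Prop) :
  linear_subspace (fun x : H => forall y, S y -> inner x y = RtoC 0).
Proof.
  split.
  - intros y _; apply inner_zero_l.
  - intros x x' hx hx' y hy. rewrite inner_plus_l, hx, hx' by exact hy. ring.
  - intros a x hx y hy. rewrite inner_scal_l, hx by exact hy. ring.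
Qed.

Lemma orth_closed (S : H -> Prop) :
  closed (fun x : H => forall y, S y -> inner x y = RtoC 0).
Proof.
  apply closed_norm_approx. intros x hx y hy. apply Cmod_eq_0.
  apply Rle_antisym; [|apply Cmod_ge_0]. apply Rnot_lt_le. intros hpos.
  pose proof (@norm_ge_0 C_AbsRing H y) as ny.
  destruct (hx (Cmod (inner x y) / (norm y + 1))) as [z [hz nz]].
  { apply Rdiv_lt_0_compat; lra. }
  assert (e : Cmod (inner (minus z x) y) = Cmod (inner x y)).
  { unfold minus.
    replace (opp x) with (scal (opp one : C_AbsRing) x)
      by exact (@scal_opp_one C_AbsRing H x).
    rewrite inner_plus_l, inner_scal_l, (hz y hy), Cplus_0_l, Cmod_mult.
    change (opp one : C_AbsRing) with (Copp (RtoC 1)).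
    rewrite Cmod_opp, Cmod_1. ring. }
  pose proof (cauchy_schwarz (minus z x) y) as cs. rewrite e in cs.
  apply Rmult_lt_compat_r with (r := norm y + 1) in nz; [|lra].
  replace (Cmod (inner x y) / (norm y + 1) * (norm y + 1))
    with (Cmod (inner x y)) in nz by (field; lra).
  pose proof (@norm_ge_0 C_AbsRing H (minus z x)). nra.
Qed.

Definition orth_compl (S : closed_subspace H) : closed_subspace H :=
  ClosedSubspace (orth_linear (mem S)) (orth_closed (S := mem S)).

(** The projection theorem provides exactly one operator with this property. *)
Definition orth_proj (S : closed_subspace H) : blin H S :=
  epsilon (inhabits (blin_zero H S))
    (fun p => forall x y, mem S y -> inner (minus x (sub_val (p x))) y = RtoC 0).

End HilbertFacts.

(** [C^n] on [W] in the sense of Fréchet derivatives in operator norm. *)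
Fixpoint is_Cn (n : nat) (E F : NormedModule R_AbsRing)
    (W : E -> Prop) (f : E -> F) : Prop :=
  match n with
  | O => forall x, W x -> continuous f x
  | S n => exists df : E -> LR E F,
      (forall x, W x -> filterdiff f (locally x) (df x : blin E F)) /\
      is_Cn n (F := LR E F) W df
  end.

Definition smooth_on (E F : NormedModule R_AbsRing) (W : E -> Prop) (f : E -> F) : Prop :=
  open W /\ forall n, is_Cn n W f.

Record chart (X : Type) := Chart
  { chart_model : NormedModule R_AbsRing;
    chart_dom : X -> Prop;
    chart_map : X -> chart_model }.

(** Charts of one atlas may take values in different Banach spaces. The topology
    of the manifold is the one given by the atlas, see [manifold_open]. *)
Definition atlas (X : Type) := chart X -> Prop.

Definition chart_image (X : Type) (c : chart X) (V : X -> Prop) : chart_model c -> Prop :=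
  fun e => exists x, V x /\ chart_dom c x /\ chart_map c x = e.

Definition manifold_open (X : Type) (A : atlas X) (V : X -> Prop) : Prop :=
  forall c, A c -> open (chart_image (c := c) V).

(** In particular [f] is continuous: the sets [c (dom c ∩ f^-1 (dom d))] are open. *)
Definition smooth_map (X Y : Type) (A : atlas X) (B : atlas Y) (f : X -> Y) : Prop :=
  forall c d, A c -> B d ->
    exists g : chart_model c -> chart_model d,
      (forall x, chart_dom c x -> chart_dom d (f x) ->
         g (chart_map c x) = chart_map d (f x)) /\
      smooth_on (chart_image (c := c) (fun x => chart_dom d (f x))) g.

(** Taking [c = d] in the last clause, the images of the charts are open. *)
Definition banach_manifold (X : Type) (A : atlas X) : Prop :=
  (forall c, A c -> inhabited (CompleteSpace.mixin_of (chart_model c))) /\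
  (forall x, exists c, A c /\ chart_dom c x) /\
  (forall c, A c -> forall x y, chart_dom c x -> chart_dom c y ->
     chart_map c x = chart_map c y -> x = y) /\
  smooth_map A A (fun x => x).

(** [(z, x) |-> h z x] is smooth on the open subset [V * F] of [X * F]. *)
Definition smooth_family (X : Type) (A : atlas X) (V : X -> Prop)
    (F G : NormedModule R_AbsRing) (h : X -> F -> G) : Prop :=
  forall c, A c ->
    exists g : prod_NormedModule R_AbsRing (chart_model c) F -> G,
      (forall z x, V z -> chart_dom c z -> g (chart_map c z, x) = h z x) /\
      smooth_on (fun p : prod_NormedModule R_AbsRing (chart_model c) F =>
                   chart_image (c := c) V (fst p)) g.

Section VectorBundle.

(** The bundle is given by its fibers; [D] is the total space [{z : Z & D z}]. *)
Variables (Z : Type) (A : atlas Z) (E : CBanach) (D : Z -> CBanach).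

(** A trivialization over [V] is [V * E -> D], [(z, x) |-> Psi z x]; the values of
    [Psi z] for [z] outside [V] are irrelevant. *)
Definition transition_smooth (V : Z -> Prop) (Psi : forall z, E -> D z)
    (W : Z -> Prop) (Phi : forall z, E -> D z) : Prop :=
  exists h : Z -> realify E -> realify E,
    (forall z x, V z -> W z -> Phi z (h z x) = Psi z x) /\
    smooth_family A (fun z => V z /\ W z) h.

Variable triv : (Z -> Prop) -> (forall z, E -> D z) -> Prop.

(** Membership in the maximal bundle atlas generated by [triv]. *)
Definition trivialization (V : Z -> Prop) (Psi : forall z, E -> D z) : Prop :=
  manifold_open A V /\
  (forall z, V z -> linear_iso (Psi z)) /\
  (forall W Phi, triv W Phi ->
     transition_smooth V Psi W Phi /\ transition_smooth W Phi V Psi).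

Definition vector_bundle : Prop :=
  (forall z, exists V Psi, triv V Psi /\ V z) /\
  (forall V Psi, triv V Psi -> trivialization V Psi).

End VectorBundle.

Definition strong_duality_pairing (E F : CBanach) (b : E -> F -> C) : Prop :=
  (forall p : E * F, continuous (fun q : E * F => b (fst q) (snd q)) p) /\
  (forall x x' y, b (plus x x') y = Cplus (b x y) (b x' y)) /\
  (forall (a : C_AbsRing) x y, b (scal a x) y = Cmult a (b x y)) /\
  (forall x y y', b x (plus y y') = Cplus (b x y) (b x y')) /\
  (forall (a : C_AbsRing) x y, b x (scal a y) = Cmult (Cconj a) (b x y)) /\
  (exists L : E -> LC (conj_space F) C_NormedModule,
     (forall x y, (L x : blin (conj_space F) C_NormedModule) y = b x y) /\
     linear_iso L) /\
  (exists L : conj_space F -> LC E C_NormedModule,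
     (forall x y, (L y : blin E C_NormedModule) x = b x y) /\
     linear_iso L).

(** The data of a like-Hermitian bundle that enter algebraic morphisms and kernels.
    The pairing of the fibers over [s] and [t] carries the proof that [t] is
    [star s], which avoids transports along [star (star s) = s]. *)
Record lh_family := LhFamily
  { base : Type;
    star : base -> base;
    starK : forall s, star (star s) = s;
    fiber : base -> CBanach;
    pairing : forall s t, t = star s -> fiber s -> fiber t -> C }.
Arguments star {l} s.
Arguments starK {l} s.
Arguments fiber {l} s.
Arguments pairing {l s t} e x y.

Record like_hermitian_bundle := LikeHermitianBundle
  { lh_fam :> lh_family;
    lh_atlas : atlas (base lh_fam);
    lh_typical_fiber : CBanach;
    lh_triv : (base lh_fam -> Prop) ->
              (forall z : base lh_fam, lh_typical_fiber -> fiber z) -> Prop;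
    lh_manifold : banach_manifold lh_atlas;
    lh_star_smooth : smooth_map lh_atlas lh_atlas (@star lh_fam);
    lh_vector_bundle : vector_bundle lh_atlas lh_triv;
    lh_strong_duality : forall s : base lh_fam,
      strong_duality_pairing (pairing (eq_refl (star s)));
    lh_conj : forall (s t : base lh_fam) (e : t = star s) (e' : s = star t)
        (x : fiber s) (y : fiber t),
      Cconj (pairing e x y) = pairing e' y x;
    lh_pairing_smooth : forall V Psi Psi',
      trivialization lh_atlas lh_triv V Psi ->
      trivialization lh_atlas lh_triv (fun w => exists z, V z /\ w = star z) Psi' ->
      smooth_family lh_atlas V
        (F := prod_NormedModule R_AbsRing (realify lh_typical_fiber)
                (realify lh_typical_fiber))
        (G := realify C_NormedModule)
        (fun z p => pairing (eq_refl (star z)) (Psi z (fst p)) (Psi' (star z) (snd p))) }.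

Record morphism (P Q : lh_family) := Morphism
  { mor_base : base P -> base Q;
    mor_star : forall z, mor_base (star z) = star (mor_base z);
    mor_fiber : forall z, blin (fiber z) (fiber (mor_base z)) }.
Arguments mor_base {P Q} m z.
Arguments mor_star {P Q} m z.
Arguments mor_fiber {P Q} m z.

Definition kernel (P : lh_family) := forall s t : base P, blin (fiber t) (fiber s).

Lemma mor_star_eq (P Q : lh_family) (Theta : morphism P Q) (s t : base P) :
  t = star s -> mor_base Theta t = star (mor_base Theta s).
Proof. intros e. rewrite e. apply mor_star. Qed.

(** [(delta_s)^{-*} : D_{zeta(t)} -> D~_t] where [t] is [star s]; it exists and is
    unique as soon as the pairings of [P] are strong duality pairings and the one of
    [Q] is continuous. *)
Definition star_adjoint (P Q : lh_family) (Theta : morphism P Q)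
    (s t : base P) (e : t = star s) : blin (fiber (mor_base Theta t)) (fiber t) :=
  epsilon (inhabits (blin_zero _ _))
    (fun A => forall x y,
       pairing (mor_star_eq Theta e) (mor_fiber Theta s x) y = pairing e x (A y)).

Definition pull_back (P Q : lh_family) (Theta : morphism P Q) (K : kernel Q) : kernel P :=
  fun s t =>
    blin_comp (star_adjoint Theta (eq_sym (starK s)))
      (blin_comp (K (mor_base Theta s) (mor_base Theta t)) (mor_fiber Theta t)).

(** The [n + 1] points are [t 0, ..., t n]. *)
Definition reproducing_kernel (P : lh_family) (K : kernel P) : Prop :=
  forall (n : nat) (t : nat -> base P) (eta : forall j, fiber (star (t j))),
    let z : C := sum_n (fun l => sum_n (fun j =>
      pairing (eq_refl (star (t l))) (K (t l) (star (t j)) (eta j)) (eta l) : C) n) n in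
    0 <= Re z /\ Im z = 0.

Arguments pull_back {P Q} Theta K s t.

Section Rkhs.

Variables (P : lh_family) (K : kernel P).

Definition bundle_section := forall s : base P, fiber s.

Definition kernel_section (s : base P) (xi : fiber s) : bundle_section :=
  fun r => K r s xi.

Inductive kernel_span : bundle_section -> Prop :=
| kernel_span_zero : kernel_span (fun _ => zero)
| kernel_span_gen : forall (s : base P) (xi : fiber s), kernel_span (kernel_section xi)
| kernel_span_plus : forall f g, kernel_span f -> kernel_span g ->
    kernel_span (fun s => plus (f s) (g s))
| kernel_span_scal : forall (a : C_AbsRing) f, kernel_span f ->
    kernel_span (fun s => scal a (f s)).

(** A Hilbert space completion of the span of the sections [K_xi] for the scalar
    product of [rk_inner]: [rk_emb] is only constrained on [kernel_span], where it
    is linear and isometric with dense range. *)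
Record rkhs := Rkhs
  { rk_space :> hilbert;
    rk_emb : bundle_section -> rk_space;
    rk_plus : forall f g, kernel_span f -> kernel_span g ->
      rk_emb (fun s => plus (f s) (g s)) = plus (rk_emb f) (rk_emb g);
    rk_scal : forall (a : C_AbsRing) f, kernel_span f ->
      rk_emb (fun s => scal a (f s)) = scal a (rk_emb f);
    rk_inner : forall (s t : base P) (xi : fiber s) (eta : fiber t),
      inner (rk_emb (kernel_section eta)) (rk_emb (kernel_section xi)) =
      pairing (eq_sym (starK s)) (K (star s) t eta) xi;
    rk_dense : forall x : rk_space,
      closure (fun y => exists f, kernel_span f /\ y = rk_emb f) x }.

Variable H : rkhs.

Definition K_hat (s : base P) (xi : fiber s) : H := rk_emb H (kernel_section xi).

Lemma K_hat_plus (s : base P) (xi xi' : fiber s) :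
  K_hat (plus xi xi') = plus (K_hat xi) (K_hat xi').
Proof.
  unfold K_hat. rewrite <- rk_plus by apply kernel_span_gen. f_equal.
  apply functional_extensionality_dep. intros r. unfold kernel_section.
  apply (linear_plus _ (blin_is_linear (K r s))).
Qed.

Lemma K_hat_scal (s : base P) (a : C_AbsRing) (xi : fiber s) :
  K_hat (scal a xi) = scal a (K_hat xi).
Proof.
  unfold K_hat. rewrite <- rk_scal by apply kernel_span_gen. f_equal.
  apply functional_extensionality_dep. intros r. unfold kernel_section.
  apply (linear_scal _ (blin_is_linear (K r s))).
Qed.

Lemma K_hat_range_linear (s : base P) :
  linear_subspace (V := H) (fun v => exists xi : fiber s, v = K_hat xi).
Proof.
  split.
  - exists (scal (zero : C_AbsRing) zero). rewrite K_hat_scal.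
    symmetry. apply (@scal_zero_l C_AbsRing H).
  - intros x y [xi ->] [xi' ->]. exists (plus xi xi'). symmetry; apply K_hat_plus.
  - intros a x [xi ->]. exists (scal a xi). symmetry; apply K_hat_scal.
Qed.

Definition zeta_K (s : base P) : closed_subspace H :=
  closed_span (K_hat_range_linear s).

End Rkhs.

Section Tautological.

Variable H : hilbert.

Definition Gr := closed_subspace H.

Definition taut := { S : Gr & S }.

Definition is_graph (S T : Gr) (A : LC S (orth_compl S)) : Prop :=
  forall v : H, mem T v <->
    exists x : S,
      v = plus (sub_val x) (sub_val ((A : blin S (orth_compl S)) x)).

(** The chart around [S]: the complements of the orthogonal space of [S] are the
    graphs of the bounded operators from [S] to it. *)
Definition Gr_chart (S : Gr) : chart Gr :=
  Chart (chart_model := realify (LC S (orth_compl S)))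
    (fun T => exists A, is_graph (S := S) T A)
    (fun T => epsilon (inhabits (blin_zero S (orth_compl S))) (is_graph (S := S) T)).

Definition Gr_atlas : atlas Gr := fun c => exists S, c = Gr_chart S.

(** For [T] in the chart around [S], [p_S] is an isomorphism of [T] onto [S]. *)
Definition taut_chart (S : Gr) : chart taut :=
  Chart
    (chart_model := prod_NormedModule R_AbsRing (chart_model (Gr_chart S)) (realify S))
    (fun p => chart_dom (Gr_chart S) (projT1 p))
    (fun p => (chart_map (Gr_chart S) (projT1 p), orth_proj S (sub_val (projT2 p)))).

Definition taut_atlas : atlas taut := fun c => exists S, c = taut_chart S.

(** [inv_base] is [omega], and [gamma] is given by its restrictions to the fibers,
    which encodes its compatibility with the projection. That [gamma_S] is bijective
    follows from [inv_inverse] for [S] and [inv_base S]. *)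
Record involutive_morphism := InvolutiveMorphism
  { inv_base : Gr -> Gr;
    inv_fiber : forall S : Gr, blin S (inv_base S);
    inv_base_smooth : smooth_map Gr_atlas Gr_atlas inv_base;
    inv_total_smooth : smooth_map taut_atlas taut_atlas
      (fun p => existT (fun S : Gr => S : Type) (inv_base (projT1 p))
                  (inv_fiber (projT1 p) (projT2 p)));
    inv_baseK : forall S, inv_base (inv_base S) = S;
    inv_isometric : forall (S : Gr) (x : S), norm (inv_fiber S x) = norm x;
    inv_inverse : forall (S : Gr) (x : S),
      sub_val (inv_fiber (inv_base S) (inv_fiber S x)) = sub_val x;
    inv_inner : forall (S1 S2 : Gr) (x1 : S1) (x2 : S2),
      inner (sub_val x1) (sub_val x2) =
      inner (sub_val (inv_fiber S1 x1)) (sub_val (inv_fiber S2 x2)) }.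

Variable Omega : involutive_morphism.

Definition taut_family : lh_family :=
  LhFamily (base := Gr) (star := inv_base Omega) (inv_baseK Omega)
    (fiber := fun S => S)
    (fun S T _ x y => inner (sub_val x) (sub_val (inv_fiber Omega T y))).

Definition Q_kernel : kernel taut_family :=
  fun S1 S2 : Gr =>
    blin_comp (orth_proj S1)
      (blin_comp (sub_incl (inv_base Omega S2)) (inv_fiber Omega S2)).

End Tautological.

Arguments Q_kernel {H} Omega s t.

(* Main.v *)
From Stdlib Require Import Reals Lra.
From Stdlib Require Import FunctionalExtensionality ProofIrrelevance.
From Stdlib Require Import ClassicalEpsilon.
From Coquelicot Require Import Coquelicot.
Require Import Defs.

Set Implicit Arguments.
Unset Strict Implicit.
Unset Printing Implicit Defensive.

(** The fiber maps of the morphism are [delta_s xi = K_xi], with values in the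
    closure [zeta_K s] of the range of [K_hat] on the fiber over [s]. They are
    bounded since the square of the norm of [K_xi] is [(K (star s) s xi | xi)], and
    both the pairing and the operator [K (star s) s] are bounded.

    To compare [K] with the pull-back, write [p] for the orthogonal projections
    and [gamma] for the isometries of [Omega]. For [xi] over [star s] and [eta]
    over [t], with [S = zeta_K s] and [T = zeta_K t], the defining property of the
    adjoint of [delta] turns [(xi | (pull_back K) s t eta)] into
    [(K_xi | gamma_S (p_S (gamma_T K_eta)))] in the Hilbert space. As
    [K_xi] lies in [zeta_K (star s) = omega S], compatibility of [gamma] with the
    inner product moves [gamma_S] to the other side, where it produces
    [gamma K_xi], a vector of [S]; the projection can then be dropped, and a second
    use of the same compatibility leaves [(K_xi | K_eta)], which is
    [(xi | K s t eta)] by the reproducing property. Nondegeneracy of the pairing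
    concludes.

    Two existence results make this computation legitimate, because the
    projections and the adjoints are specified only by their characteristic
    properties: the projection theorem in a Hilbert space
    ([orth_proj_spec]), and the representation of bounded sesquilinear forms through
    a strong duality pairing ([sesquilinear_representation]). *)

(** * Orthogonal projections *)

Section Projection.

Variable H : hilbert.
Implicit Types x y z u w : H.

Lemma inner_opp_l x y : inner (opp x) y = Copp (inner x y).
Proof.
  replace (opp x) with (scal (opp one : C_AbsRing) x)
    by exact (@scal_opp_one C_AbsRing H x).
  rewrite inner_scal_l. change (opp one : C_AbsRing) with (Copp (RtoC 1)). ring.
Qed.

Lemma inner_minus_l x y z : inner (minus x y) z = Cminus (inner x z) (inner y z).
Proof. unfold minus. rewrite inner_plus_l, inner_opp_l. reflexivity. Qed.

Lemma inner_minus_r x y z : inner x (minus y z) = Cminus (inner x y) (inner x z).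
Proof.
  rewrite <- inner_conj, inner_minus_l, <- (inner_conj y x), <- (inner_conj z x).
  apply injective_projections; simpl; ring.
Qed.

(** Removing from [w] its component along [u] lowers the square of the norm by
    [|(w | u)|^2 / |u|^2], which cannot exceed the excess of [w] over the infimum
    [m]. *)
Lemma near_minimizer_almost_orthogonal (S : closed_subspace H) (m e : R) w u :
  0 <= e ->
  (forall v, mem S v -> m <= norm (minus w v) * norm (minus w v)) ->
  norm w * norm w <= m + e * e -> mem S u ->
  Cmod (inner w u) <= e * norm u.
Proof.
  intros he hm hw hu.
  pose proof (@norm_ge_0 C_AbsRing H u) as nu.
  destruct (Req_dec (norm u) 0) as [z | nz].
  { eapply Rle_trans; [apply cauchy_schwarz|]. rewrite z. lra. }
  set (a := inner w u). set (n := norm u * norm u).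
  assert (hn : 0 < n) by (unfold n; nra).
  set (c := Cdiv a (RtoC n)).
  assert (key : norm (minus w (scal (c : C_AbsRing) u)) * norm (minus w (scal (c : C_AbsRing) u))
          = norm w * norm w - Cmod a ^ 2 / n).
  { apply RtoC_inj. rewrite <- inner_norm.
    rewrite inner_minus_l, !inner_minus_r, !inner_scal_l, !inner_scal_r.
    rewrite <- (inner_conj w u), !inner_norm. fold a n.
    rewrite RtoC_minus, RtoC_div, Cmod2_conj by lra.
    replace (Cconj c) with (Cdiv (Cconj a) (RtoC n)).
    - unfold c. field. intros h. apply RtoC_inj in h. lra.
    - unfold c, Cdiv. rewrite Cmult_conj, <- RtoC_inv by lra.
      f_equal. apply injective_projections; simpl; lra. }
  assert (h : m <= norm w * norm w - Cmod a ^ 2 / n).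
  { rewrite <- key. apply hm, (subspace_scal (mem_linear S)), hu. }
  assert (h2 : Cmod a ^ 2 / n <= e * e) by lra.
  apply Rmult_le_compat_r with (r := n) in h2; [|lra].
  unfold Rdiv in h2. rewrite Rmult_assoc, Rinv_l, Rmult_1_r in h2 by lra.
  apply Rsqr_incr_0_var; [unfold Rsqr, n in *; lra | apply Rmult_le_pos; assumption].
Qed.

Lemma nonneg_infimum (A : Type) (P : A -> Prop) (f : A -> R) :
  (exists a, P a) -> (forall a, 0 <= f a) ->
  exists m, (forall a, P a -> m <= f a) /\
    forall e, 0 < e -> exists a, P a /\ f a < m + e.
Proof.
  intros [a0 h0] hf.
  destruct (completeness (fun r => exists a, P a /\ r = - f a)) as [m [ub lub]].
  - exists 0. intros r [a [_ ->]]. specialize (hf a); lra.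
  - exists (- f a0), a0; auto.
  - exists (- m). split.
    + intros a ha. enough (- f a <= m) by lra. apply ub. exists a; auto.
    + intros e he. apply Classical_Prop.NNPP. intros hn.
      enough (m <= m - e) by lra. apply lub. intros r [a [ha ->]].
      apply Rnot_lt_le. intros hl. apply hn. exists a. split; [exact ha | lra].
Qed.

(** The points of [S] whose squared distance to [x] is within [e ^ 2] of the
    infimum form, as [e] decreases, the base of a filter on [S]. It is Cauchy because
    the residuals [x - y] and [x - z] of two such points are almost orthogonal to
    [y - z], and its limit has a residual orthogonal to [S]. *)
Lemma projection_exists (S : closed_subspace H) x :
  exists p : S, forall u, mem S u -> inner (minus x (sub_val p)) u = RtoC 0.
Proof.
  destruct (nonneg_infimum (P := mem S) (f := fun y => norm (minus x y) * norm (minus x y)))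
    as [m [hm hinf]].
  { exists zero. apply (subspace_zero (mem_linear S)). }
  { intros a. apply Rle_0_sqr. }
  set (near := fun (e : R) (y : S) =>
    norm (minus x (sub_val y)) * norm (minus x (sub_val y)) < m + e * e).
  assert (near_orth : forall e (y : S) u, 0 < e -> near e y -> mem S u ->
            Cmod (inner (minus x (sub_val y)) u) <= e * norm u).
  { intros e y u he hy hu. apply near_minimizer_almost_orthogonal with (S := S) (m := m); auto.
    - lra.
    - intros v hv.
      replace (minus (minus x (sub_val y)) v) with (minus x (plus (sub_val y) v)).
      + apply hm. apply (subspace_plus (mem_linear S) (proj2_sig y) hv).
      + unfold minus.
        etransitivity; [| apply (@plus_assoc H)]. f_equal. apply (@opp_plus H).
    - apply Rlt_le. exact hy. }
  set (F := fun P : S -> Prop => exists e, 0 < e /\ forall y : S, near e y -> P y).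
  assert (PF : ProperFilter F).
  { split.
    - intros P [e [he h]]. destruct (hinf (e * e)) as [y [hy ly]]; [nra|].
      exists (exist (mem S) y hy : sub_carrier S). apply h. exact ly.
    - split.
      + exists 1. split; [lra | auto].
      + intros P Q [e [he h]] [e' [he' h']]. exists (Rmin e e').
        assert (0 < Rmin e e') by (apply Rmin_pos; assumption).
        pose proof (Rmin_l e e'). pose proof (Rmin_r e e').
        split; [assumption|]. unfold near in *.
        intros y hy. split; [apply h | apply h']; nra.
      + intros P Q hPQ [e [he h]]. exists e. split; auto. }
  assert (CF : cauchy F).
  { intros eps. set (e := eps / 3).
    assert (he : 0 < e) by (unfold e; pose proof (cond_pos eps); lra).
    destruct (hinf (e * e)) as [y [hy ly]]; [nra|].
    exists (exist (mem S) y hy : sub_carrier S). exists e. split; [exact he|]. intros z hz.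
    apply (@norm_compat1 C_AbsRing S).
    change (norm (minus (sub_val z) y) < eps).
    assert (hd : mem S (minus (sub_val z) y)).
    { apply (subspace_plus (mem_linear S) (proj2_sig z)), mem_opp, hy. }
    pose proof (near_orth e z _ he hz hd) as h1.
    pose proof (near_orth e (exist (mem S) y hy : sub_carrier S) _ he ly hd) as h2. simpl in h2.
    set (d := minus (sub_val z) y) in *.
    assert (hs : norm d * norm d <= e * norm d + e * norm d).
    { rewrite <- (Rabs_pos_eq (norm d * norm d)) by apply Rle_0_sqr.
      rewrite <- Cmod_R, <- inner_norm.
      replace (inner d d) with (Cplus (inner (minus x y) d) (Copp (inner (minus x (sub_val z)) d))).
      - eapply Rle_trans; [apply Cmod_triangle|]. rewrite Cmod_opp. lra.
      - replace (inner d d) with (Cminus (inner (sub_val z) d) (inner y d))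
          by (symmetry; apply inner_minus_l).
        rewrite !inner_minus_l. ring. }
    pose proof (@norm_ge_0 C_AbsRing H d).
    assert (norm d <= 2 * e) by nra. unfold e in *. pose proof (cond_pos eps). lra. }
  pose proof (complete_cauchy F PF CF) as hl. set (p := lim F) in *.
  exists p. intros u hu.
  apply Cmod_eq_0, Rle_antisym; [|apply Cmod_ge_0]. apply le_epsilon. intros e he.
  pose proof (@norm_ge_0 C_AbsRing H u) as nu.
  set (k := @norm_factor C_AbsRing S).
  assert (hk : 0 < k) by apply norm_factor_gt_0.
  set (e1 := e / ((1 + k) * (norm u + 1))).
  assert (he1 : 0 < e1) by (apply Rdiv_lt_0_compat; nra).
  assert (hF : F (near e1)) by (exists e1; auto).
  destruct (filter_ex _ (filter_and _ _ (hl (mkposreal e1 he1)) hF)) as [y [hb hy]].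
  apply (@norm_compat2 C_AbsRing S) in hb. simpl in hb. fold k in hb.
  change (norm (minus (sub_val y) (sub_val p)) < k * e1) in hb.
  pose proof (near_orth e1 y u he1 hy hu) as h1.
  pose proof (cauchy_schwarz (minus (sub_val y) (sub_val p)) u) as h2.
  replace (inner (minus x (sub_val p)) u)
    with (Cplus (inner (minus x (sub_val y)) u) (inner (minus (sub_val y) (sub_val p)) u))
    by (rewrite !inner_minus_l; ring).
  eapply Rle_trans; [apply Cmod_triangle|].
  assert (he2 : e1 * ((1 + k) * (norm u + 1)) = e) by (unfold e1; field; nra).
  nra.
Qed.

Lemma projection_unique (S : closed_subspace H) x (p q : S) :
  (forall u, mem S u -> inner (minus x (sub_val p)) u = RtoC 0) ->
  (forall u, mem S u -> inner (minus x (sub_val q)) u = RtoC 0) -> p = q.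
Proof.
  intros hp hq. apply sub_val_inj.
  set (d := minus (sub_val p) (sub_val q)).
  assert (hd : mem S d)
    by (apply (subspace_plus (mem_linear S) (proj2_sig p)), mem_opp, (proj2_sig q)).
  assert (h : inner d d = RtoC 0).
  { transitivity (Cminus (inner (minus x (sub_val q)) d) (inner (minus x (sub_val p)) d)).
    - unfold d at 1. rewrite !inner_minus_l. ring.
    - rewrite hp, hq by exact hd. ring. }
  rewrite inner_norm in h. apply RtoC_inj in h.
  assert (n0 : norm d = 0) by nra.
  apply (@norm_eq_zero C_AbsRing H) in n0.
  assert (e : plus d (sub_val q) = sub_val q) by (rewrite n0; apply plus_zero_l).
  rewrite <- e. unfold d, minus. rewrite <- plus_assoc, plus_opp_l, plus_zero_r.
  reflexivity.
Qed.

(** By uniqueness the points provided by [projection_exists] depend linearly on [x],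
    and [|p x|^2 = (x | p x) <= |x| |p x|] bounds the resulting map: it is a candidate
    for the choice made in [orth_proj]. *)
Lemma orth_proj_spec (S : closed_subspace H) x y :
  mem S y -> inner (minus x (sub_val (orth_proj S x))) y = RtoC 0.
Proof.
  unfold orth_proj. revert x y. apply epsilon_spec.
  set (p := fun x => proj1_sig (constructive_indefinite_description _
                                  (projection_exists S x))).
  assert (hp : forall x u, mem S u -> inner (minus x (sub_val (p x))) u = RtoC 0)
    by (intros x; exact (proj2_sig (constructive_indefinite_description _
                                      (projection_exists S x)))).
  unshelve eexists (Blin p _); [|exact hp]. split.
  - intros x y. apply projection_unique with (plus x y); [apply hp|].
    intros u hu. specialize (hp x u hu) as h1. specialize (hp y u hu) as h2.
    rewrite inner_minus_l in h1, h2. rewrite inner_minus_l, inner_plus_l.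
    change (sub_val (plus (p x) (p y))) with (plus (sub_val (p x)) (sub_val (p y))).
    rewrite inner_plus_l. rewrite <- (Cplus_0_l (RtoC 0)), <- h1 at 1.
    rewrite <- h2. ring.
  - intros a x. apply projection_unique with (scal a x); [apply hp|].
    intros u hu. specialize (hp x u hu) as h1.
    rewrite inner_minus_l in h1. rewrite inner_minus_l, inner_scal_l.
    change (sub_val (scal a (p x))) with (scal a (sub_val (p x))).
    rewrite inner_scal_l.
    transitivity (Cmult a (Cminus (inner x u) (inner (sub_val (p x)) u))); [ring|].
    rewrite h1. ring.
  - exists 1. split; [lra|]. intros x. rewrite Rmult_1_l.
    change (norm (p x)) with (norm (sub_val (p x))).
    pose proof (hp x _ (proj2_sig (p x))) as h. fold (sub_val (p x)) in h.
    rewrite inner_minus_l, inner_norm in h.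
    pose proof (cauchy_schwarz x (sub_val (p x))) as cs.
    pose proof (@norm_ge_0 C_AbsRing H (sub_val (p x))).
    pose proof (@norm_ge_0 C_AbsRing H x).
    replace (inner x (sub_val (p x))) with (RtoC (norm (sub_val (p x)) * norm (sub_val (p x)))) in cs.
    + rewrite Cmod_R, Rabs_pos_eq in cs by nra. nra.
    + symmetry. apply Ceq_minus. exact h.
Qed.

Lemma inner_orth_proj_r (S : closed_subspace H) x y :
  mem S y -> inner y (sub_val (orth_proj S x)) = inner y x.
Proof.
  intros hy. rewrite <- (inner_conj x y), <- (inner_conj _ y). f_equal.
  symmetry. apply Ceq_minus. rewrite <- inner_minus_l. apply orth_proj_spec, hy.
Qed.

End Projection.

(** * Representation of sesquilinear forms by a strong duality pairing *)

Section StrongDuality.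

Variables (E F : CBanach) (b : E -> F -> C).
Hypothesis duality : strong_duality_pairing b.

(** The norm of [x] controls the one of the functional [(x | .)], because
    [x |-> (x | .)] is a bounded operator. *)
Lemma strong_duality_bounded :
  exists M, 0 < M /\ forall x y, Cmod (b x y) <= M * norm x * norm y.
Proof.
  destruct duality as (_ & _ & _ & _ & _ & [L [hL [lin _]]] & _).
  destruct (linear_norm _ lin) as [M [hM h]].
  exists M. split; [exact hM|]. intros x y. rewrite <- hL.
  eapply Rle_trans;
    [exact (op_norm_le (L x : blin (conj_space F) C_NormedModule) y)|].
  apply Rmult_le_compat_r; [apply (@norm_ge_0 C_AbsRing F) | exact (h x)].
Qed.

Lemma strong_duality_nondegenerate (u v : F) :
  (forall x, b x u = b x v) -> u = v.
Proof.
  intros huv.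
  destruct duality as (_ & _ & _ & _ & _ & _ & [L [hL [_ [g [_ [gL _]]]]]]).
  rewrite <- (gL u), <- (gL v). f_equal.
  apply (blin_ext (f := L u : blin E C_NormedModule) (g := L v)).
  intros x. rewrite !hL. apply huv.
Qed.

(** The functionals [c . y] are of the form [b . (A y)] as [v |-> b . v] is onto the
    dual of [E]. Both [y |-> c . y] and [v |-> b . v] are antilinear and bounded,
    the latter with bounded inverse, so that [A] is linear and bounded. *)
Lemma sesquilinear_representation (G : NormedModule C_AbsRing) (c : E -> G -> C) (M : R) :
  (forall x x' y, c (plus x x') y = Cplus (c x y) (c x' y)) ->
  (forall (a : C_AbsRing) x y, c (scal a x) y = Cmult a (c x y)) ->
  (forall x y y', c x (plus y y') = Cplus (c x y) (c x y')) ->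
  (forall (a : C_AbsRing) x y, c x (scal a y) = Cmult (Cconj a) (c x y)) ->
  0 < M -> (forall x y, Cmod (c x y) <= M * norm x * norm y) ->
  exists A : blin G F, forall x y, c x y = b x (A y).
Proof.
  intros cpl cscl cpr cscr hM hc.
  destruct duality as (_ & _ & _ & _ & _ & _ & [L [hL [_ [g [glin [gL Lg]]]]]]).
  assert (lin : forall y, is_linear (fun x => c x y : C_NormedModule)).
  { intros y. pose proof (@norm_ge_0 C_AbsRing G y) as ny.
    split.
    - intros x x'. apply cpl.
    - intros a x. apply cscl.
    - exists (M * norm y + 1). split; [nra|]. intros x.
      pose proof (@norm_ge_0 C_AbsRing E x). specialize (hc x y).
      change (Cmod (c x y) <= (M * norm y + 1) * norm x). nra. }
  set (f := fun y => Blin (fun x => c x y : C_NormedModule) (lin y) : LC E C_NormedModule).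
  assert (fnorm : forall y, norm (f y) <= M * norm y).
  { intros y. apply op_norm_min.
    - apply Rmult_le_pos; [lra | apply (@norm_ge_0 C_AbsRing G)].
    - intros x. specialize (hc x y).
      change (Cmod (c x y) <= M * norm y * norm x). lra. }
  assert (Alin : is_linear (fun y => g (f y) : F)).
  { split.
    - intros y y'. etransitivity; [| apply (linear_plus _ glin)]. f_equal.
      apply blin_ext. intros x. apply cpr.
    - intros a y.
      transitivity (g (scal (Cconj a : C_AbsRing) (f y))).
      + f_equal. apply blin_ext. intros x. apply cscr.
      + rewrite (linear_scal _ glin).
        change (scal (Cconj (Cconj a) : C_AbsRing) (g (f y) : F) = scal a (g (f y) : F)).
        rewrite Cconj_conj. reflexivity.
    - destruct (linear_norm _ glin) as [N [hN hg]].
      exists (N * M). split; [nra|]. intros y.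
      eapply Rle_trans; [exact (hg (f y))|].
      rewrite Rmult_assoc. apply Rmult_le_compat_l; [lra | apply fnorm]. }
  exists (Blin _ Alin). intros x y. simpl. rewrite <- hL, Lg. reflexivity.
Qed.

End StrongDuality.

(** * The pull-back of the tautological kernel *)

(** This form of the pairing makes the properties over [s] and [star s] available
    over [star s] and [s]. *)
Lemma pairing_strong_duality (P : like_hermitian_bundle) (s t : base P) (e : t = star s) :
  strong_duality_pairing (pairing e).
Proof. subst t. apply lh_strong_duality. Qed.

(** The adjoint of [Theta] represents the form [(x, y) |-> (Theta x | gamma y)] of the
    Hilbert space, which is bounded as [gamma] is isometric. *)
Lemma star_adjoint_spec (P : like_hermitian_bundle) (H : hilbert)
    (Omega : involutive_morphism H) (Theta : morphism P (taut_family Omega))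
    (s t : base P) (e : t = star s) x y :
  pairing (mor_star_eq Theta e) (mor_fiber Theta s x) y =
  pairing e x (star_adjoint Theta e y).
Proof.
  revert x y. unfold star_adjoint. apply epsilon_spec.
  destruct (linear_norm _ (blin_is_linear (mor_fiber Theta s))) as [M [hM hd]].
  apply (sesquilinear_representation (pairing_strong_duality e)) with (M := M).
  - intros x x' y. rewrite (linear_plus _ (blin_is_linear (mor_fiber Theta s))).
    apply inner_plus_l.
  - intros a x y. rewrite (linear_scal _ (blin_is_linear (mor_fiber Theta s))).
    apply inner_scal_l.
  - intros x y y'. simpl.
    rewrite (linear_plus _ (blin_is_linear (inv_fiber Omega _))). apply inner_plus_r.
  - intros a x y. simpl.
    rewrite (linear_scal _ (blin_is_linear (inv_fiber Omega _))). apply inner_scal_r.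
  - exact hM.
  - intros x y. simpl. eapply Rle_trans; [apply cauchy_schwarz|].
    change (norm (mor_fiber Theta s x) * norm (inv_fiber Omega (mor_base Theta t) y)
              <= M * norm x * norm y).
    rewrite inv_isometric. apply Rmult_le_compat_r; [| apply hd].
    apply (@norm_ge_0 C_AbsRing (mor_base Theta t)).
Qed.

Section Feature.

Variables (P : like_hermitian_bundle) (K : kernel P) (H : rkhs K).

(** The equation of [rk_inner], freed from its double involution. *)
Lemma inner_K_hat (r s t : base P) (e : s = star r) (xi : fiber s) (eta : fiber t) :
  inner (K_hat H eta) (K_hat H xi) = pairing e (K r t eta) xi.
Proof.
  assert (er : r = star s) by (rewrite e, starK; reflexivity).
  subst r. rewrite (proof_irrelevance _ e (eq_sym (starK s))). apply rk_inner.
Qed.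

(** The square of [|K_xi|] is [(K (star s) s xi | xi)]; the [+ 1] in the witness avoids
    a square root. *)
Lemma K_hat_bounded (s : base P) :
  exists M, 0 < M /\ forall xi : fiber s, norm (K_hat H xi) <= M * norm xi.
Proof.
  set (e := eq_sym (starK s)).
  destruct (strong_duality_bounded (pairing_strong_duality e)) as [M [hM hb]].
  destruct (linear_norm _ (blin_is_linear (K (star s) s))) as [N [hN hK]].
  exists (M * N + 1). assert (hMN : 0 < M * N) by (apply Rmult_lt_0_compat; assumption).
  split; [lra|]. intros xi.
  pose proof (@norm_ge_0 C_AbsRing H (K_hat H xi)) as n1.
  pose proof (@norm_ge_0 C_AbsRing (fiber s) xi) as n2.
  assert (hsq : norm (K_hat H xi) * norm (K_hat H xi) <= M * N * (norm xi * norm xi)).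
  { rewrite <- (Rabs_pos_eq (norm (K_hat H xi) * _)) by apply Rle_0_sqr.
    rewrite <- Cmod_R, <- inner_norm, (inner_K_hat e).
    eapply Rle_trans; [apply hb|].
    specialize (hK xi). apply Rmult_le_compat_r with (r := M * norm xi) in hK; nra. }
  apply Rsqr_incr_0_var; [unfold Rsqr | nra]. nra.
Qed.

Lemma K_hat_in_zeta (s : base P) (xi : fiber s) : mem (zeta_K H s) (K_hat H xi).
Proof.
  intros eps he. exists (K_hat H xi). split; [exists xi; reflexivity|].
  rewrite minus_eq_zero.
  eapply Rle_lt_trans; [apply Req_le; exact (@norm_zero C_AbsRing H) | exact he].
Qed.

Definition feature_fun (s : base P) (xi : fiber s) : zeta_K H s :=
  exist (mem (zeta_K H s)) (K_hat H xi) (K_hat_in_zeta xi).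

Lemma feature_linear (s : base P) : is_linear (@feature_fun s).
Proof.
  split.
  - intros x y. apply sub_val_inj, K_hat_plus.
  - intros a x. apply sub_val_inj, K_hat_scal.
  - apply K_hat_bounded.
Qed.

Variable Omega : involutive_morphism H.
Hypothesis zeta_K_star : forall s : base P,
  zeta_K H (star s) = inv_base Omega (zeta_K H s).

Definition feature_morphism : morphism P (taut_family Omega) :=
  Morphism (Q := taut_family Omega) zeta_K_star (fun s => Blin _ (feature_linear s)).

End Feature.

(** As [gamma] preserves inner products and inverts itself, [(x | gamma_S z)] is
    [(gamma x | z)]. The vector [gamma x] lies in [S], so that the projection to [S]
    inside [z] may be dropped; then [(gamma x | gamma y) = (x | y)]. *)
Lemma inner_Q_kernel (H : hilbert) (Omega : involutive_morphism H)
    (S' S T : Gr H) (e : S' = inv_base Omega S) (x : S') (y : T) :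
  inner (sub_val x) (sub_val (inv_fiber Omega S (Q_kernel Omega S T y))) =
  inner (sub_val x) (sub_val y).
Proof.
  set (z := Q_kernel Omega S T y).
  rewrite (inv_inner Omega x (inv_fiber Omega S z)), inv_inverse.
  rewrite (inv_inner Omega x y).
  apply inner_orth_proj_r.
  assert (h : mem (inv_base Omega S') (sub_val (inv_fiber Omega S' x)))
    by exact (proj2_sig (inv_fiber Omega S' x)).
  revert h. generalize (sub_val (inv_fiber Omega S' x)). intros v.
  rewrite e, inv_baseK. auto.
Qed.

Theorem theorem5p1
  (P : like_hermitian_bundle)
  (K : kernel P)
  (K_reproducing : reproducing_kernel K)
  (H : rkhs K)
  (Omega : involutive_morphism H)
  (zeta_K_star : forall s : base P,
     zeta_K H (star s) = inv_base Omega (zeta_K H s)) :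
  exists Delta : morphism P (taut_family Omega),
    mor_base Delta = zeta_K H /\
    K = pull_back Delta (Q_kernel Omega).
Proof.
  set (Delta := feature_morphism zeta_K_star).
  exists Delta. split; [reflexivity|].
  apply functional_extensionality_dep; intros s.
  apply functional_extensionality_dep; intros t.
  apply blin_ext; intros eta.
  set (e := eq_sym (starK s)).
  apply (strong_duality_nondegenerate (pairing_strong_duality e)). intros xi.
  etransitivity;
    [| exact (star_adjoint_spec (Theta := Delta) e xi
         (Q_kernel Omega (zeta_K H s) (zeta_K H t) (feature_fun H eta)))].
  rewrite <- (lh_conj (eq_refl (star s))), <- (inner_K_hat H), inner_conj.
  symmetry.
  exact (inner_Q_kernel (zeta_K_star s) (feature_fun H xi) (feature_fun H eta)).
Qed.
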